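(* Let $\mathcal U$ be a configuration (a collection of random variables) with corresponding occupancy counts $\mathbf M=(M_\alpha)_{\alpha\in[m]}=F(\mathcal U)$ for a measurable function $F$, where for all $\alpha\in[m]=\{1,\dots,m\}$ the component $M_\alpha$ is lattice log concave with support $\mathcal S_\alpha\subset\mathbb Z$, and let $a_\alpha=\inf\mathcal S_\alpha$. Let $\mathbf w=(w_\alpha)_{\alpha\in[m]}\in(0,\infty)^m$, $\mathbf d=(d_\alpha)_{\alpha\in[m]}\in\mathbb Z^m$, $|\mathbf w|=\max_\alpha w_\alpha$, and $$Y_{ge}=\sum_{\alpha\in[m]}w_\alpha\mathbf 1(M_\alpha\ge d_\alpha),\qquad Y_{ne}=\sum_{\alpha\in[m]}w_\alpha\mathbf 1(M_\alpha\ne d_\alpha).$$ Suppose that for every $\alpha\in[m]$ there exist configurations $\{\mathcal U_a^\alpha: a\in\mathcal S_\alpha\}$ on a common probability space satisfying $\mathcal L(\mathcal U_a^\alpha)=\mathcal L(\mathcal U\mid M_\alpha=a)$ for all $a\in\mathcal S_\alpha$. Let $B\ge0$. 1. Suppose $0<P(M_\alpha\ge d_\alpha)<1$ for all $\alpha\in[m]$. If $\{\mathcal U_a^\alpha,a\in\mathcal S_\alpha\}$ has Property $(B,\ge)$ and $a_\alpha>-\infty$ for all $\alpha\in[m]$, then there exists a coupling of variables $Y$ and $Y^s$ on the same space such that $\mathcal L(Y)=\mathcal L(Y_{ge})$, $Y^s$ has the $Y_{ge}$-size bias distribution, and $$Y^s\le Y+|\mathbf w|\left(B|\mathbf d-\mathbf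 a|+1\right),\qquad\text{where } |\mathbf d-\mathbf a|=\max_{\alpha\in[m]}(d_\alpha-a_\alpha).$$ 2. Suppose $0<P(M_\alpha\ne d_\alpha)<1$ for all $\alpha\in[m]$. If $\{\mathcal U_a^\alpha,a\in\mathcal S_\alpha\}$ has Property $(B,\ne)$ for all $\alpha\in[m]$, then there exists a coupling of variables $Y$ and $Y^s$ on the same space such that $\mathcal L(Y)=\mathcal L(Y_{ne})$, $Y^s$ has the $Y_{ne}$-size bias distribution, and $$Y^s\le Y+|\mathbf w|(B+1).$$
   Context: $\mathcal L$ denotes law. The support of a discrete random variable $M$ is $\{x:P(M=x)>0\}$. An integer valued $M$ with mass function $p_x$ is lattice log concave (LC) if its support equals $(k_1,k_2)\cap\mathbb Z$ for some $k_1,k_2\in\mathbb Z\cup\{\pm\infty\}$ with $k_1<k_2-1$, and $p_x^2\ge p_{x-1}p_{x+1}$ for all $x\in\mathbb Z$. A nonnegative $Y$ with mean $\mu\in(0,\infty)$ has size bias distribution the law of any $Y^s$ with $E[Yf(Y)]=\mu E[f(Y^s)]$ for all $f$ for which these expectations exist. Properties: the counts corresponding to a configuration $\mathcal V$ are $F(\mathcal V)$. Let $\mathbf N_a^\alpha=(N_{\beta,a}^\alpha)_{\beta\in[m]}=F(\mathcal U_a^\alpha)$. The collection $\{\mathcal U_a^\alpha,a\in\mathcal S_\alpha\}$ has Property $(B,\ge,\alpha)$ if (almost surely) $$\sum_{\beta\ne\alpha}w'_\beta\mathbf 1(N_{\beta,a+1}^\alpha\ge d'_\beta)\le\sum_{\beta\ne\alpha}w'_\beta\mathbf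 1(N_{\beta,a}^\alpha\ge d'_\beta)+|\mathbf w'|B\quad\text{for all }\{a,a+1\}\subset\mathcal S_\alpha,$$ and Property $(B,\ne,\alpha)$ if (almost surely) $$\sum_{\beta\ne\alpha}w'_\beta\mathbf 1(N_{\beta,b}^\alpha\ne d'_\beta)\le\sum_{\beta\ne\alpha}w'_\beta\mathbf 1(N_{\beta,a}^\alpha\ne d'_\beta)+|\mathbf w'|B\quad\text{for all }\{a,b\}\subset\mathcal S_\alpha\text{ with }|b-a|=1,$$ in each case for all $\mathbf w'\in(0,\infty)^m$ (with $|\mathbf w'|=\max_\beta w'_\beta$) and all $\mathbf d'\in\mathbb Z^m$. Property $(B,\ge)$ (resp. $(B,\ne)$) means that Property $(B,\ge,\alpha)$ (resp. $(B,\ne,\alpha)$) holds for all $\alpha\in[m]$. Inequalities between coupled random variables are meant almost surely. *)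

(* Defs.v *)
From HB Require Import structures.
From mathcomp Require Import all_boot all_order all_algebra.
From mathcomp Require Import all_classical all_reals all_analysis.

Set Implicit Arguments.
Unset Strict Implicit.
Unset Printing Implicit Defensive.

Import Order.TTheory GRing.Theory Num.Theory.
Import numFieldNormedType.Exports.

Local Open Scope classical_set_scope.
Local Open Scope ring_scope.

HB.instance Definition _ := isPointed.Build int 0.
HB.instance Definition _ := @isMeasurable.Build default_measure_display
  int discrete_measurable discrete_measurable0
  discrete_measurableC discrete_measurableU.

Section Laws.
Context {R : realType}.

(* The quantifier over measurable sets is essential: equality of [pushforward]s
   as set functions would also compare the junk values of [P] and [P'] on
   nonmeasurable sets. *)
Definition same_law {d d' d0 : measure_display} {T : measurableType d}
    {T' : measurableType d'} {E : measurableType d0}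
    (P : probability T R) (X : T -> E) (P' : probability T' R) (X' : T' -> E) :
    Prop :=
  forall A : set E, measurable A -> P (X @^-1` A) = P' (X' @^-1` A).

Definition cond_prob {d : measure_display} {T : measurableType d}
    (P : probability T R) (A C : set T) : R :=
  fine (P (A `&` C)) / fine (P C).

(* L(X') = L(X | C); only meaningful when [P C] is positive. *)
Definition has_cond_law {d d' d0 : measure_display} {T : measurableType d}
    {T' : measurableType d'} {E : measurableType d0}
    (P' : probability T' R) (X' : T' -> E)
    (P : probability T R) (X : T -> E) (C : set T) : Prop :=
  measurable_fun setT X' /\
  forall A : set E, measurable A ->
    P' (X' @^-1` A) = (cond_prob P (X @^-1` A) C)%:E.

Definition size_bias {d d' : measure_display} {T : measurableType d}
    {T' : measurableType d'} (P : probability T R) (Y : T -> R)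
    (P' : probability T' R) (Ys : T' -> R) : Prop :=
  [/\ {ae P, forall x, 0 <= Y x},
      (0 < 'E_P[Y] < +oo)%E
    & forall f : R -> R, measurable_fun setT f ->
        P.-integrable setT (fun x => (Y x * f (Y x))%:E) ->
        P'.-integrable setT (fun x => (f (Ys x))%:E) ->
        ('E_P[fun x => (Y x * f (Y x))%R] =
         'E_P[Y] * 'E_P'[fun x => f (Ys x)])%E].

End Laws.

Section LatticeLogConcave.
Context {R : realType} {d : measure_display} {T : measurableType d}.
Variable P : probability T R.

Definition int_pmf (M : T -> int) (x : int) : R := fine (P (M @^-1` [set x])).

Definition int_support (M : T -> int) : set int := [set x | 0 < int_pmf M x].

Definition lattice_log_concave (M : T -> int) : Prop :=
  (exists k1 k2 : \bar int,
     (k1 < k2 - 1%:E)%E /\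
     int_support M = [set x : int | (k1 < x%:E < k2)%E]) /\
  forall x : int,
    int_pmf M (x - 1) * int_pmf M (x + 1) <= int_pmf M x ^+ 2.

Definition inf_support (M : T -> int) : \bar R :=
  ereal_inf [set (x%:~R : R)%:E | x in int_support M].

End LatticeLogConcave.

(* The default value 0 is harmless: this is only used for a nonempty index set
   and a family of positive numbers. *)
Definition maxf {R : realType} (m : nat) (v : 'I_m -> R) : R :=
  \big[Num.max/0]_(b < m) v b.

Section Properties.
Context {R : realType} {m : nat} {d : measure_display} {T : measurableType d}.
(* [N a x b] is the count of type [b] in the [a]-th configuration. *)
Variables (P : probability T R) (S : set int) (N : int -> T -> 'I_m -> int).

Definition property_ge (B : R) (alpha : 'I_m) : Prop :=
  forall a : int, S a -> S (a + 1) ->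
  forall (w : 'I_m -> R) (c : 'I_m -> int), (forall b, 0 < w b) ->
  {ae P, forall x,
    \sum_(b < m | b != alpha) w b * (c b <= N (a + 1) x b)%R%:R <=
    \sum_(b < m | b != alpha) w b * (c b <= N a x b)%R%:R + maxf w * B}.

Definition property_ne (B : R) (alpha : 'I_m) : Prop :=
  forall a a' : int, S a -> S a' -> `|a' - a| = 1 ->
  forall (w : 'I_m -> R) (c : 'I_m -> int), (forall b, 0 < w b) ->
  {ae P, forall x,
    \sum_(b < m | b != alpha) w b * (N a' x b != c b)%:R <=
    \sum_(b < m | b != alpha) w b * (N a x b != c b)%:R + maxf w * B}.

End Properties.

Definition size_bias_coupling_le {R : realType} {d : measure_display}
    {T : measurableType d} (P : probability T R) (Y0 : T -> R) (K : R) : Prop :=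
  exists (d' : measure_display) (T' : measurableType d')
         (P' : probability T' R) (Y Ys : {RV P' >-> R}),
    [/\ same_law P' Y P Y0,
        size_bias P Y0 P' Ys
      & {ae P', forall x, Ys x <= Y x + K}].

(* Main.v *)
(** Condition on [M alpha]: the size-biased law of the weighted sum [Y] is the
    mixture over [alpha], with weights proportional to
    [w alpha * P (M alpha \in D alpha)], of the laws of [Y] given
    [M alpha \in D alpha], where [D alpha] is the success set
    ([>= d alpha] or [!= d alpha]).  Draw [u] uniformly on ]0, 1[, independently
    of the configurations, and let [q] and [q'] be the quantiles at [u] of
    [M alpha] and of [M alpha] given [M alpha \in D alpha]; the configurations
    [V alpha q] and [V alpha q'] then have the law of [U] and that of [U] given
    [M alpha \in D alpha].  Log-concavity passes from the mass function to the
    distribution function and to the tail, and comparing distribution functions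
    yields [q <= q' <= q + (d alpha - a alpha)] for [>=] and [`|q' - q| <= 1] for
    [!=].  Moving from [q] to [q'] by unit steps costs [B] per step for the types
    other than [alpha], and at most [w alpha] for [alpha] itself. *)

Require Import Defs.
From HB Require Import structures.
From mathcomp Require Import all_boot all_order all_algebra.
From mathcomp Require Import all_classical all_reals all_analysis.
From mathcomp Require Import measurable_realfun zify ring lra.

Set Implicit Arguments.
Unset Strict Implicit.
Unset Printing Implicit Defensive.

Import Order.TTheory GRing.Theory Num.Theory.
Import numFieldNormedType.Exports.

Local Open Scope classical_set_scope.
Local Open Scope ring_scope.

(** * Log-concave sequences and distribution functions *)

Section LogConcaveSequence.
Context {R : realFieldType}.
Variable p : int -> R.
Hypothesis p_ge0 : forall x, 0 <= p x.
Hypothesis p_lc : forall x, p (x - 1) * p (x + 1) <= p x ^+ 2.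
Hypothesis p_conv : forall s x t, 0 < p s -> 0 < p t -> s <= x <= t -> 0 < p x.

(** Induction on [n]: multiply the induction hypothesis by log-concavity at [s + n + 1] and cancel
    [p (s + n) * p (s + n + 1)]. These factors are positive by [p_conv] unless an endpoint vanishes,
    and then the left side is zero. *)
Lemma log_concave_squeeze1 (n : nat) s :
  p s * p (s + n.+1%:Z) <= p (s + 1) * p (s + n%:Z).
Proof.
elim: n => [|n IH]; first by rewrite addr0 mulrC.
have [->|ps0] := eqVneq (p s) 0; first by rewrite mul0r mulr_ge0.
have [->|pt0] := eqVneq (p (s + n.+2%:Z)) 0; first by rewrite mulr0 mulr_ge0.
have ps : 0 < p s by rewrite lt0r ps0 p_ge0.
have pt : 0 < p (s + n.+2%:Z) by rewrite lt0r pt0 p_ge0.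
have pn : 0 < p (s + n%:Z) by apply: (p_conv ps pt); lia.
have pn1 : 0 < p (s + n.+1%:Z) by apply: (p_conv ps pt); lia.
have := p_lc (s + n.+1%:Z).
have -> : s + n.+1%:Z - 1 = s + n%:Z by lia.
have -> : s + n.+1%:Z + 1 = s + n.+2%:Z by lia.
move=> lc; rewrite -(ler_pM2r pn) -(ler_pM2r pn1).
have -> : p s * p (s + n.+2%:Z) * p (s + n%:Z) * p (s + n.+1%:Z) =
  (p s * p (s + n.+1%:Z)) * (p (s + n%:Z) * p (s + n.+2%:Z)) by ring.
have -> : p (s + 1) * p (s + n.+1%:Z) * p (s + n%:Z) * p (s + n.+1%:Z) =
  (p (s + 1) * p (s + n%:Z)) * p (s + n.+1%:Z) ^+ 2 by ring.
by apply: ler_pM => //; exact: mulr_ge0.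
Qed.

(** One inward move by [log_concave_squeeze1] leaves the same claim for [s + 1] and [s + n - 1],
    with [k] lowered by one and [n] by two; for [k = n] the two points merely swap. *)
Lemma log_concave_squeeze (k n : nat) s : (k <= n)%N ->
  p s * p (s + n%:Z) <= p (s + k%:Z) * p (s + n%:Z - k%:Z).
Proof.
elim: k n s => [|k IH] n s; first by rewrite addr0 subr0.
rewrite leq_eqVlt => /predU1P[<-|]; first by rewrite addrK mulrC.
case: n => [|[|n]] // kn.
apply: (le_trans (log_concave_squeeze1 _ _)).
have := IH n (s + 1) kn.
have -> : s + 1 + n%:Z = s + n.+1%:Z by lia.
have -> : s + 1 + k%:Z = s + k.+1%:Z by lia.
by have -> : s + n.+2%:Z - k.+1%:Z = s + n.+1%:Z - k%:Z by lia.
Qed.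

End LogConcaveSequence.

(** * Integer variables: fibers and distribution functions *)

Section Fibers.
Context {R : realType} {d : measure_display} {T : measurableType d}.
Implicit Types (mu : {measure set T -> \bar R}) (A : set T).

Lemma fibersE (N : T -> nat) A : A = \bigcup_k (A `&` N @^-1` [set k]).
Proof. by apply/seteqP; split=> [x Ax|x [k _ []]//]; exists (N x). Qed.

(** Measurability is asked only of the traces on [A], so that [N] may be any labelling of the
    pieces. *)
Lemma measure_fibers mu (N : T -> nat) A :
  (forall k, measurable (A `&` N @^-1` [set k])) ->
  mu A = (\sum_(0 <= k <oo) mu (A `&` N @^-1` [set k]))%E.
Proof.
move=> mA; rewrite [in LHS](fibersE N A) measure_bigcup//.
- by apply: eq_eseriesl => k; rewrite in_setT.
- apply/trivIsetP => i j _ _ /eqP ij; rewrite -subset0 => x.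
  by move=> [[_ /= Ni] [_ /= Nj]]; apply: ij; rewrite -Ni.
Qed.

End Fibers.

Section IntegerValued.
Context {R : realType} {d : measure_display} {T : measurableType d}.
Variables (P : probability T R) (M : T -> int).
Hypothesis mM : measurable_fun setT M.

Lemma measurable_int_preimage (D : set int) : measurable (M @^-1` D).
Proof. by rewrite -[_ @^-1` _]setTI; exact: mM. Qed.

Definition int_cdf (a : int) : R := fine (P (M @^-1` [set x | x <= a])).

Lemma int_pmf_ge0 x : 0 <= int_pmf P M x.
Proof. exact: fine_ge0. Qed.

Lemma int_pmfE x : (int_pmf P M x)%:E = P (M @^-1` [set x]).
Proof. by rewrite fineK// fin_num_measure//; exact: measurable_int_preimage. Qed.

Lemma int_cdfE a : (int_cdf a)%:E = P (M @^-1` [set x | x <= a]).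
Proof. by rewrite fineK// fin_num_measure//; exact: measurable_int_preimage. Qed.

Lemma int_cdf_ge0 a : 0 <= int_cdf a.
Proof. exact: fine_ge0. Qed.

Lemma int_cdf_le1 a : int_cdf a <= 1.
Proof.
by rewrite -lee_fin int_cdfE probability_le1//; exact: measurable_int_preimage.
Qed.

Lemma int_cdfD1 a : int_cdf a = int_cdf (a - 1) + int_pmf P M a.
Proof.
apply: EFin_inj; rewrite EFinD !int_cdfE int_pmfE -measureU.
- congr (P _); apply/seteqP; split=> x /=.
    by rewrite le_eqVlt => /predU1P[|?]; [right|left; lia].
  by case=> [|->//]; lia.
- exact: measurable_int_preimage.
- exact: measurable_int_preimage.
- by rewrite -subset0 => x [/=] ? ?; lia.
Qed.

Lemma int_cdf_series a :
  ((int_cdf a)%:E = \sum_(0 <= k <oo) (int_pmf P M (a - k%:Z))%:E)%E.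
Proof.
(* Where [M <= a], the distance to [a] determines [M]: its [k]-th fiber is [M = a - k]. *)
rewrite int_cdfE (measure_fibers _ (N := fun x => `|a - M x|%N)).
  apply: eq_eseriesr => k _; rewrite int_pmfE; congr (P _).
  by apply/seteqP; split=> x /=; [case; lia|lia].
by move=> k; exact: (measurable_int_preimage [set x | x <= a /\ `|a - x|%N = k]).
Qed.

End IntegerValued.

(** * Log-concavity of the distribution function and of the tail *)

Section LogConcaveCdf.
Context {R : realType} {d : measure_display} {T : measurableType d}.
Variable P : probability T R.
Implicit Type M : T -> int.

Lemma lattice_log_concave_interval M s x t : lattice_log_concave P M ->
  int_support P M s -> int_support P M t -> s <= x <= t -> int_support P M x.
Proof.
move=> [[k1 [k2 [_ ->]]] _] /andP[k1s _] /andP[_ tk2] /andP[sx xt] /=.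
by rewrite (lt_le_trans k1s)//= (le_lt_trans _ tk2).
Qed.

Lemma int_cdf_nondecreasing M x y : measurable_fun setT M ->
  x <= y -> int_cdf P M x <= int_cdf P M y.
Proof.
move=> mM xy; rewrite -lee_fin !int_cdfE//.
apply: le_measure; rewrite ?inE; [exact: measurable_int_preimage..|].
by move=> z /= /le_trans; exact.
Qed.

(** Splitting off the last mass in [F x] and [F y] and removing the common product leaves
    [F (x - 1) * p y <= p x * F (y - 1)]. Expanded in series this holds term by term: the points
    [x - 1 - i] and [y] move inward by [i + 1]. *)
Lemma int_cdf_log_concave M x y : measurable_fun setT M ->
  (forall x, int_pmf P M (x - 1) * int_pmf P M (x + 1) <= int_pmf P M x ^+ 2) ->
  (forall s x t, 0 < int_pmf P M s -> 0 < int_pmf P M t -> s <= x <= t ->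
    0 < int_pmf P M x) ->
  x <= y ->
  int_cdf P M (x - 1) * int_cdf P M y <= int_cdf P M x * int_cdf P M (y - 1).
Proof.
move=> mM lc conv xy.
rewrite (int_cdfD1 P mM y) (int_cdfD1 P mM x) mulrDr mulrDl lerD2l mulrC.
rewrite -lee_fin !EFinM !int_cdf_series// -!nneseriesZl; last 2 first.
  by move=> i _; rewrite lee_fin int_pmf_ge0.
  by move=> i _; rewrite lee_fin int_pmf_ge0.
apply: lee_nneseries => [i _ _|i _]; rewrite -!EFinM lee_fin.
  by rewrite mulr_ge0// int_pmf_ge0.
have := @log_concave_squeeze _ _ (int_pmf_ge0 P M) lc conv
  i.+1 (absz (y - (x - 1 - i%:Z))%R) (x - 1 - i%:Z).
have -> : x - 1 - i%:Z + (absz (y - (x - 1 - i%:Z))%R)%:Z = y by lia.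
have -> : x - 1 - i%:Z + i.+1%:Z = x by lia.
have -> : y - i.+1%:Z = y - 1 - i%:Z by lia.
by rewrite mulrC; apply; lia.
Qed.

Variable M : T -> int.
Hypotheses (mM : measurable_fun setT M) (M_lc : lattice_log_concave P M).

Let F := int_cdf P M.
(** The tail P(M >= x). *)
Let G x := 1 - F (x - 1).

Lemma int_cdf_lc x y : x <= y -> F (x - 1) * F y <= F x * F (y - 1).
Proof.
apply: int_cdf_log_concave => //; first by case: M_lc.
by move=> s z t ps pt; exact: (lattice_log_concave_interval M_lc ps pt).
Qed.

Lemma int_cdf_opp x : int_cdf P (fun t => - M t) x = G (- x).
Proof.
apply: EFin_inj; rewrite /G EFinB !int_cdfE//; last first.
  move=> _ Y _; rewrite setTI.
  exact: (measurable_int_preimage mM [set z | Y (- z)]).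
rewrite -probability_setC; last exact: measurable_int_preimage.
by congr (P _); apply/seteqP; split=> z /=; lia.
Qed.

(** Reflection: [- M] is again log-concave, and its distribution function is the tail of [M] at the
    opposite point. *)
Lemma int_tail_lc x y : x <= y -> G x * G (y + 1) <= G (x + 1) * G y.
Proof.
move=> xy.
have pE z : int_pmf P (fun t => - M t) z = int_pmf P M (- z).
  by congr (fine (P _)); apply/seteqP; split=> t /=; lia.
have := @int_cdf_log_concave (fun t => - M t) (- y) (- x).
have oppE (z : int) : - (- z - 1) = z + 1 by lia.
rewrite !int_cdf_opp !opprK !oppE.
move=> H; rewrite mulrC [leRHS]mulrC; apply: H; last by lia.
- move=> _ Y _; rewrite setTI.
  exact: (measurable_int_preimage mM [set z | Y (- z)]).
- move=> z; rewrite !pE mulrC.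
  have -> : - (z + 1) = - z - 1 by lia.
  have -> : - (z - 1) = - z + 1 by lia.
  by case: M_lc => _; exact.
- move=> s z t; rewrite !pE => ps pt szt.
  by apply: (lattice_log_concave_interval M_lc pt ps); lia.
Qed.

(** Product of the one-step inequalities at [x + k] and [y + k] for [k < n]. If a factor to be
    cancelled vanishes, monotonicity of the tail makes the left side zero. *)
Lemma int_tail_submultiplicative (n : nat) x y : x <= y ->
  G x * G (y + n%:Z) <= G (x + n%:Z) * G y.
Proof.
have G0 z : 0 <= G z by rewrite subr_ge0 int_cdf_le1.
move=> xy; elim: n => [|n IH]; first by rewrite !addr0.
have -> : x + n.+1%:Z = x + n%:Z + 1 by lia.
have -> : y + n.+1%:Z = y + n%:Z + 1 by lia.
have [Gxn|Gxn] := eqVneq (G (x + n%:Z)) 0.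
  have -> : G (y + n%:Z + 1) = 0.
    apply/eqP; rewrite eq_le G0 andbT -Gxn lerD2l lerN2.
    by apply: int_cdf_nondecreasing => //; lia.
  by rewrite mulr0 mulr_ge0.
have Gxn0 : 0 < G (x + n%:Z) by rewrite lt0r Gxn G0.
have [Gyn|Gyn] := eqVneq (G (y + n%:Z)) 0.
  have -> : G (y + n%:Z + 1) = 0.
    apply/eqP; rewrite eq_le G0 andbT -Gyn lerD2l lerN2.
    by apply: int_cdf_nondecreasing => //; lia.
  by rewrite mulr0 mulr_ge0.
have Gyn0 : 0 < G (y + n%:Z) by rewrite lt0r Gyn G0.
have step : G (x + n%:Z) * G (y + n%:Z + 1) <= G (x + n%:Z + 1) * G (y + n%:Z).
  by apply: int_tail_lc; lia.
rewrite -(ler_pM2r Gxn0) -(ler_pM2r Gyn0).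
have -> : G x * G (y + n%:Z + 1) * G (x + n%:Z) * G (y + n%:Z) =
  (G x * G (y + n%:Z)) * (G (x + n%:Z) * G (y + n%:Z + 1)) by ring.
have -> : G (x + n%:Z + 1) * G y * G (x + n%:Z) * G (y + n%:Z) =
  (G (x + n%:Z) * G y) * (G (x + n%:Z + 1) * G (y + n%:Z)) by ring.
by apply: ler_pM => //; exact: mulr_ge0.
Qed.

End LogConcaveCdf.

(** * Comparison of a log-concave law with its conditional laws *)

Section Conditioning.
Context {R : realType} {d : measure_display} {T : measurableType d}.
Variable P : probability T R.

(* [P] is only the junk value required by [mnormalize]. *)
Lemma exists_normalized (mu : {measure set T -> \bar R}) (c : R) :
  mu setT = c%:E -> 0 < c ->
  exists P' : probability T R, forall A, P' A = (mu A * c^-1%:E)%E.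
Proof.
move=> muT c0; exists (mnormalize mu P) => A.
by rewrite /= /mnormalize muT eqe (gt_eqF c0) /=.
Qed.

Lemma exists_cond_probability (C : set T) : measurable C -> (0 < P C)%E ->
  exists PC : probability T R,
    forall A, measurable A -> PC A = (cond_prob P A C)%:E.
Proof.
move=> mC PC0.
have finA B : measurable B -> P B \is a fin_num by exact: fin_num_measure.
have [||PC PCE] := @exists_normalized (mrestr P mC) (fine (P C)).
- by transitivity (P (setT `&` C)) => //; rewrite setTI fineK// finA.
- by rewrite fine_gt0// PC0/= ltey_eq finA.
- exists PC => A mA; rewrite PCE.
  transitivity (P (A `&` C) * (fine (P C))^-1%:E)%E => //.
  by rewrite -(fineK (finA _ (measurableI _ _ mA mC))).
Qed.

End Conditioning.

Section Comparison.
Context {R : realType} {d : measure_display} {T : measurableType d}.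
Variables (P PC : probability T R) (M : T -> int) (D : set int).
Hypotheses (mM : measurable_fun setT M) (M_lc : lattice_log_concave P M).
Hypothesis PD0 : (0 < P (M @^-1` D))%E.
Hypothesis PC_law : forall A, measurable A ->
  PC A = (cond_prob P A (M @^-1` D))%:E.

Let F := int_cdf P M.
Let FC := int_cdf PC M.
Let q := fine (P (M @^-1` D)).

Let q_gt0 : 0 < q.
Proof.
apply: fine_gt0; rewrite PD0/= ltey_eq fin_num_measure//.
exact: measurable_int_preimage.
Qed.

(** Clears the denominator: the comparisons below are made after multiplication by [q]. *)
Let FCE a : FC a * q = fine (P (M @^-1` [set x | x <= a /\ D x])).
Proof.
apply: EFin_inj; rewrite EFinM int_cdfE// PC_law; last exact: measurable_int_preimage.
by rewrite -EFinM /cond_prob -/q -mulrA mulVf ?mulr1 ?gt_eqF.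
Qed.

Let F_mono x y : x <= y -> F x <= F y.
Proof. exact: int_cdf_nondecreasing. Qed.

Let F_ge0 x : 0 <= F x. Proof. exact: int_cdf_ge0. Qed.

Let F_le1 x : F x <= 1. Proof. exact: int_cdf_le1. Qed.

Let P_itv a b : a <= b ->
  fine (P (M @^-1` [set x | a < x <= b])) = F b - F a.
Proof.
move=> ab; suff -> : F b = F a + fine (P (M @^-1` [set x | a < x <= b])) by lra.
rewrite /F /int_cdf -fineD ?fin_num_measure//; try exact: measurable_int_preimage.
rewrite -measureU; try exact: measurable_int_preimage.
- by congr (fine (P _)); apply/seteqP; split=> x /=; [lia|case; lia].
- by rewrite -subset0 => x [/=]; lia.
Qed.

Section AtLeast.
Variable c : int.
Hypothesis DE : D = [set x | c <= x].

Let qE : q = 1 - F (c - 1).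
Proof.
apply: EFin_inj; rewrite EFinB int_cdfE// -probability_setC; last first.
  exact: measurable_int_preimage.
rewrite /q fineK; last by rewrite fin_num_measure//; exact: measurable_int_preimage.
by congr (P _); apply/seteqP; split=> x /=; rewrite DE/=; lia.
Qed.

Let FC_lt a : a < c -> FC a = 0.
Proof.
move=> ac; apply: (mulIf (lt0r_neq0 q_gt0)); rewrite FCE mul0r DE.
rewrite (_ : _ @^-1` _ = set0) ?measure0//.
by rewrite -subset0 => x /= []; lia.
Qed.

Let FC_ge a : c <= a -> FC a * q = F a - F (c - 1).
Proof.
move=> ca; rewrite FCE DE -P_itv; last by lia.
by congr (fine (P _)); apply/seteqP; split=> x /=; lia.
Qed.

(** From [c] on, after multiplication by [q], the claim is [F (c - 1) * F a <= F (c - 1)]. *)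
Lemma cond_ge_cdf_le a : FC a <= F a.
Proof.
have [ac|ca] := ltP a c; first by rewrite FC_lt.
rewrite -(ler_pM2r q_gt0) FC_ge// qE.
have := F_ge0 (c - 1); have := F_le1 a.
by nra.
Qed.

(** In terms of tails the claim reads P(M >= a + 1 + n) <= P(M >= a0 + n) P(M >= a + 1). This is
    submultiplicativity started at [a0], where the tail equals one. *)
Lemma cond_ge_cdf_shift (n : nat) a0 a : c = a0 + n%:Z -> F (a0 - 1) = 0 ->
  F a <= FC (a + n%:Z).
Proof.
move=> cE F0; have [aa0|a0a] := ltP a a0.
  have : F a <= F (a0 - 1) by apply: F_mono; lia.
  by rewrite F0 => /le_trans; apply; exact: int_cdf_ge0.
rewrite -(ler_pM2r q_gt0) FC_ge ?qE; last by lia.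
have := int_tail_submultiplicative mM M_lc n (_ : a0 <= a + 1).
rewrite -/F F0 subr0 mul1r cE.
rewrite (_ : a + 1 + n%:Z - 1 = a + n%:Z); last by lia.
rewrite (_ : a + 1 - 1 = a); last by lia.
by move=> /(_ ltac:(lia)); lra.
Qed.

End AtLeast.

Section NotEqual.
Variable c : int.
Hypothesis DE : D = [set x | x != c].

(** The mass at [c], written as a jump of [F] so that only values of [F] enter the inequalities. *)
Let p := F c - F (c - 1).

Let p_ge0 : 0 <= p.
Proof. by rewrite subr_ge0; apply: F_mono; lia. Qed.

Let qE : q = 1 - p.
Proof.
rewrite /p -P_itv; last by lia.
apply: EFin_inj; rewrite EFinB fineK; last first.
  by rewrite fin_num_measure//; exact: measurable_int_preimage.
rewrite fineK; last by rewrite fin_num_measure//; exact: measurable_int_preimage.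
rewrite -probability_setC; last exact: measurable_int_preimage.
by congr (P _); apply/seteqP; split=> x /=; rewrite DE/=; lia.
Qed.

Let FC_lt a : a < c -> FC a * q = F a.
Proof.
move=> ac; rewrite FCE DE.
by congr (fine (P _)); apply/seteqP; split=> x /=; lia.
Qed.

Let FC_ge a : c <= a -> FC a * q = F a - p.
Proof.
move=> ca; rewrite FCE DE.
rewrite (_ : _ @^-1` _ = M @^-1` [set x | x <= c - 1] `|`
    M @^-1` [set x | c < x <= a]); last first.
  by apply/seteqP; split=> x /=; lia.
rewrite measureU; last 3 first.
- exact: measurable_int_preimage.
- exact: measurable_int_preimage.
- by rewrite -subset0 => x /= []; lia.
rewrite fineD ?fin_num_measure//; last 2 first.
- exact: measurable_int_preimage.
- exact: measurable_int_preimage.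
by rewrite P_itv// -[X in X + _]/(F (c - 1)) /p; lra.
Qed.

(** For [a < c] the claim is [F a <= F (a + 1) * (1 - p)]. Log-concavity gives
    [F a * F c <= F (a + 1) * F (c - 1)], and [F (c - 1) = F c - p] is at most [F c * (1 - p)]; then
    [F c] cancels. For [c <= a], monotonicity and [F (a + 1) <= 1] suffice. *)
Lemma cond_neq_cdf_le a : FC a <= F (a + 1).
Proof.
have F1 : F a <= F (a + 1) by apply: F_mono; lia.
rewrite -(ler_pM2r q_gt0); have [ac|ca] := ltP a c; last first.
  rewrite FC_ge// qE; have := p_ge0; have := F_le1 (a + 1); nra.
rewrite FC_lt//.
have [Fc0|Fc0] := eqVneq (F c) 0.
  have -> : F a = 0.
    by apply/eqP; rewrite eq_le F_ge0 andbT -Fc0; apply: F_mono; lia.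
  by rewrite mulr_ge0// ltW.
have Fc : 0 < F c by rewrite lt0r Fc0 F_ge0.
rewrite -(ler_pM2r Fc).
have := int_cdf_lc mM M_lc (_ : a + 1 <= c).
rewrite (_ : a + 1 - 1 = a); last by lia.
move=> /(_ ltac:(lia)) /le_trans; apply.
rewrite -/F qE -mulrA ler_wpM2l//.
have := F_le1 c; have := p_ge0; rewrite /p; nra.
Qed.

(** Mirror image of the previous bound: for [c <= a + 1], log-concavity of the tail is used between
    [c] and [a + 1], and the tail at [c] cancels. *)
Lemma cond_neq_cdf_ge a : F a <= FC (a + 1).
Proof.
rewrite -(ler_pM2r q_gt0); have [ac|ca] := ltP (a + 1) c.
  rewrite FC_lt// qE; have := p_ge0; have := F_ge0 a.
  have : F a <= F (a + 1) by apply: F_mono; lia.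
  nra.
rewrite FC_ge// qE.
(* If the tail at [c] vanishes, then [F] is one from [c - 1] on and [p = 0]. *)
have [Gc0|Gc0] := eqVneq (1 - F (c - 1)) 0.
  have : F (c - 1) <= F c by apply: F_mono; lia.
  have : F (c - 1) <= F (a + 1) by apply: F_mono; lia.
  have := F_le1 c; have := F_le1 a; have := F_le1 (a + 1); rewrite /p; nra.
have Gc : 0 < 1 - F (c - 1) by rewrite lt0r Gc0 subr_ge0 F_le1.
have := int_tail_lc mM M_lc ca.
rewrite -/F (_ : a + 1 - 1 = a); last by lia.
rewrite (_ : a + 1 + 1 - 1 = a + 1); last by lia.
rewrite (_ : c + 1 - 1 = c); last by lia.
move=> lc.
suff : 1 - F (a + 1) <= (1 - F a) * (1 - p) by lra.
rewrite -(ler_pM2l Gc); apply: (le_trans lc).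
rewrite [leRHS]mulrCA mulrC. rewrite ler_wpM2l ?subr_ge0//.
by have := F_ge0 (c - 1); have := p_ge0; rewrite /p; nra.
Qed.

End NotEqual.
End Comparison.

(** * Quantile coupling *)

Section Quantile.
Context {R : realType} {d : measure_display} {T : measurableType d}.

(** Continuity from below along the events [M <= n]: were all values at most [u], their limit 1
    would be too. *)
Lemma int_cdf_gt (P : probability T R) (M : T -> int) u :
  measurable_fun setT M -> u < 1 -> exists a, u < int_cdf P M a.
Proof.
move=> mM u1; apply: contrapT => /forallNP nu.
pose A (n : nat) : set T := M @^-1` [set x | x <= n%:Z].
have mA n : measurable (A n) by exact: measurable_int_preimage.
have /cvg_lim : (P \o A) n @[n --> \oo] --> P (\bigcup_n A n).
  apply: nondecreasing_cvg_mu => //; first exact: bigcupT_measurable.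
  by move=> n k nk; apply/subsetPset => x; rewrite /A/=; lia.
have -> : \bigcup_n A n = setT.
  by apply/seteqP; split=> // x _; exists (absz (M x)) => //; rewrite /A/=; lia.
rewrite probability_setT => /(_ (@ereal_hausdorff R)) lim1.
have : (1 <= u%:E)%E.
  rewrite -lim1; apply: lime_le.
    apply: (cvgP (P (\bigcup_n A n))); apply: nondecreasing_cvg_mu => //.
      exact: bigcupT_measurable.
    by move=> n k nk; apply/subsetPset => x; rewrite /A/=; lia.
  by apply: nearW => n; rewrite /A /= -int_cdfE// lee_fin leNgt; apply/negP/nu.
by rewrite lee_fin leNgt u1.
Qed.

Lemma int_cdf_lt (P : probability T R) (M : T -> int) u :
  measurable_fun setT M -> 0 < u -> exists a, int_cdf P M a < u.
Proof.
move=> mM u0.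
have mN : measurable_fun setT (fun t => - M t).
  move=> _ Y _; rewrite setTI.
  exact: (measurable_int_preimage mM [set z | Y (- z)]).
have [|a] := @int_cdf_gt P (fun t => - M t) (1 - u) mN; first by lra.
(* The distribution function of [- M] at [a] is one minus that of [M] at [- a - 1]. *)
by rewrite int_cdf_opp// => H; exists (- a - 1); lra.
Qed.

Lemma int_cdf_bracket (P : probability T R) (M : T -> int) u :
  measurable_fun setT M -> 0 < u < 1 ->
  exists a, int_cdf P M (a - 1) < u <= int_cdf P M a.
Proof.
move=> mM /andP[u0 u1].
have [b ub] := int_cdf_gt P mM u1; have [c cu] := int_cdf_lt P mM u0.
(* Upward scan from [c], where the value is below [u], to the first crossing; [b] bounds the
   search. *)
suff H n : u <= int_cdf P M (c + n%:Z) ->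
    exists a, int_cdf P M (a - 1) < u <= int_cdf P M a.
  apply: (H (absz (b - c))); apply: (le_trans (ltW ub)).
  by apply: int_cdf_nondecreasing => //; lia.
elim: n => [|n IH]; first by rewrite addr0 leNgt cu.
move=> un1; have [/IH//|nu] := leP u (int_cdf P M (c + n%:Z)).
exists (c + n.+1%:Z); rewrite un1 andbT.
by rewrite (_ : c + n.+1%:Z - 1 = c + n%:Z)//; lia.
Qed.

(* With [x0] in the support, the values are in the support everywhere, also
   outside ]0, 1[. *)
Definition int_quantile (P : probability T R) (M : T -> int) (x0 : int) (u : R) :=
  if 0 < u < 1 then xget x0 [set a | int_cdf P M (a - 1) < u <= int_cdf P M a]
  else x0.

Variables (P : probability T R) (M : T -> int) (x0 : int).
Hypothesis mM : measurable_fun setT M.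
Let q := int_quantile P M x0.

Lemma int_quantileP u : 0 < u < 1 ->
  int_cdf P M (q u - 1) < u <= int_cdf P M (q u).
Proof.
move=> u01; rewrite /q /int_quantile u01; case: xgetP => // nex.
by have [a /nex] := int_cdf_bracket P mM u01.
Qed.

Lemma int_quantile_eqE u a : 0 < u < 1 ->
  q u = a <-> int_cdf P M (a - 1) < u <= int_cdf P M a.
Proof.
move=> u01; split=> [<-|/andP[au ua]]; first exact: int_quantileP.
have /andP[qu uq] := int_quantileP u01.
apply/eqP; rewrite eq_le !leNgt; apply/andP; split; apply/negP => lt.
  have := lt_le_trans qu ua; rewrite ltNge => /negP; apply.
  by apply: int_cdf_nondecreasing => //; lia.
have := lt_le_trans au uq; rewrite ltNge => /negP; apply.
by apply: int_cdf_nondecreasing => //; lia.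
Qed.

Lemma int_quantile_support u : int_support P M x0 -> int_support P M (q u).
Proof.
move=> Sx0; have [u01|u01] := boolP (0 < u < 1); last first.
  by rewrite /q /int_quantile (negbTE u01).
have /andP[qu uq] := int_quantileP u01.
by have := lt_le_trans qu uq; rewrite (int_cdfD1 P mM (q u)) ltrDl.
Qed.

Lemma measurable_int_quantile (D : set int) : measurable (q @^-1` D).
Proof.
rewrite (_ : _ @^-1` _ =
  \bigcup_(a : int) (q @^-1` [set a] `&` (fun=> D a))); last first.
  by apply/seteqP; split=> [u Du|u [a _ [<-]]//]; exists (q u).
apply: countable_bigcupT_measurable => // a.
have [Da|nDa] := pselect (D a); last first.
  rewrite (_ : _ `&` _ = set0)//.
  by rewrite -subset0 => u [_ ].
(* Within ]0, 1[ the fiber is a half-open interval; the default value [x0] also receives everything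
   outside. *)
rewrite (_ : _ `&` _ =
  (`]int_cdf P M (a - 1), int_cdf P M a]%classic `&` `]0%R, 1%R[%classic) `|`
   (if x0 == a then ~` `]0%R, 1%R[%classic else set0)).
  apply: measurableU; first exact: measurableI.
  by case: ifP => // _; exact: measurableC.
apply/seteqP; split=> u /=; rewrite !in_itv/=.
  move=> [qu _]; have [u01|u01] := boolP (0 < u < 1).
    by left; split=> //; exact/(int_quantile_eqE _ u01).
  move: qu; rewrite /q /int_quantile (negbTE u01) => ->.
  by right; rewrite eqxx /= in_itv/=; exact/negP.
case=> [[au u01]|]; first by split=> //; exact/(int_quantile_eqE _ u01).
case: ifP => // /eqP x0a; rewrite /= in_itv/= => /negP u01.
by split=> //; rewrite /q /int_quantile (negbTE u01).
Qed.

(** The fiber over [a] inside ]0, 1[ lies between the open and the right-closed interval from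
    [int_cdf P M (a - 1)] to [int_cdf P M a], both of length [int_pmf P M a]. *)
Lemma int_quantile_law (L : probability (measurableTypeR R) R) a :
  (forall A, measurable A -> L A = lebesgue_measure (A `&` `]0%R, 1%R[%classic)) ->
  L (q @^-1` [set a]) = P (M @^-1` [set a]).
Proof.
move=> LE; rewrite LE; last exact: measurable_int_quantile.
rewrite -int_pmfE//.
have FaE := int_cdfD1 P mM a; have p0 := int_pmf_ge0 P M a.
have F0 := int_cdf_ge0 P M (a - 1); have F1 := int_cdf_le1 P mM a.
have itvE (b : bool) :
  lebesgue_measure
    [set` Interval (BRight (int_cdf P M (a - 1))) (BSide b (int_cdf P M a))]
    = (int_pmf P M a)%:E.
  rewrite lebesgue_measure_itv/= lte_fin -EFinB.
  case: ifPn => [_|]; first by congr EFin; lra.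
  by rewrite -leNgt => ?; congr EFin; lra.
apply/eqP; rewrite eq_le; apply/andP; split.
  rewrite -(itvE false); apply: le_measure; rewrite ?inE//.
    by apply: measurableI => //; exact: measurable_int_quantile.
  by move=> u [/= qa]; rewrite !in_itv/= => u01; exact/(int_quantile_eqE _ u01).
(* The open interval is taken here because its right end may be 1, which is outside ]0, 1[. *)
rewrite -(itvE true); apply: le_measure; rewrite ?inE//.
  by apply: measurableI => //; exact: measurable_int_quantile.
move=> u /=; rewrite !in_itv/= => /andP[au ua].
have u01 : 0 < u < 1 by apply/andP; split; lra.
by split=> //; apply/(int_quantile_eqE _ u01); rewrite au ltW.
Qed.

End Quantile.

(** A violation would give [u <= F' (q') <= F (q' + k) <= F (q - 1) < u], where [F], [F'] are the
    distribution functions and [q], [q'] the quantiles. Outside ]0, 1[ both quantiles equal [x0]. *)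
Lemma int_quantile_le {R : realType} {d : measure_display} {T : measurableType d}
    (P P' : probability T R) (M : T -> int) (x0 : int) (k : int) (u : R) :
  measurable_fun setT M -> 0 <= k ->
  (forall a, int_cdf P' M a <= int_cdf P M (a + k)) ->
  int_quantile P M x0 u <= int_quantile P' M x0 u + k.
Proof.
move=> mM k0 H; have [u01|u01] := boolP (0 < u < 1); last first.
  by rewrite /int_quantile (negbTE u01) lerDl.
rewrite leNgt; apply/negP => lt.
have /andP[qu _] := int_quantileP P x0 mM u01.
have /andP[_ uq'] := int_quantileP P' x0 mM u01.
have := lt_le_trans (lt_le_trans qu uq') (H _).
rewrite ltNge => /negP; apply.
by apply: int_cdf_nondecreasing => //; lia.
Qed.

Lemma exists_uniform_probability (R : realType) :
  exists L : probability (measurableTypeR R) R,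
  forall A, measurable A -> L A = lebesgue_measure (A `&` `]0%R, 1%R[%classic).
Proof.
have mI : measurable (`]0%R, 1%R[%classic : set R) by [].
pose mu : {measure set (measurableTypeR R) -> \bar R} := @lebesgue_measure R.
(* The Dirac mass only fills the default slot of the normalization; the restricted measure already
   has mass 1. *)
have [||L LE] := @exists_normalized R _ _
  (dirac (0 : measurableTypeR R)) (mrestr mu mI) 1.
- transitivity (lebesgue_measure (setT `&` `]0%R, 1%R[%classic : set R)) => //.
  by rewrite setTI lebesgue_measure_itv/= lte_fin ltr01 sube0.
- by [].
- by exists L => A mA; rewrite LE invr1 mule1.
Qed.

(** * Size bias of a finite mixture *)

Section SimpleExpectation.
Context {R : realType} {d : measure_display} {T : measurableType d}.
Variable P : probability T R.

Lemma expectation_sum_indic (I : Type) (s : seq I) (c : I -> R) (A : I -> set T) :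
  (forall i, measurable (A i)) ->
  ('E_P[fun x => (\sum_(i <- s) c i * \1_(A i) x)%R]
   = (\sum_(i <- s) c i * fine (P (A i)))%R%:E)%E.
Proof.
move=> mA; rewrite unlock.
have int1 i : P.-integrable setT (fun x => (c i * \1_(A i) x)%:E).
  under eq_fun do rewrite EFinM.
  by apply: integrableZl => //; exact: integrable_indic.
(* Integrability is carried along the induction because additivity of the integral requires it. *)
have [_ //] :
  P.-integrable setT (fun x => (\sum_(i <- s) c i * \1_(A i) x)%:E) /\
  (\int[P]_x (\sum_(i <- s) c i * \1_(A i) x)%R%:E
   = (\sum_(i <- s) c i * fine (P (A i)))%R%:E)%E.
elim: s => [|i s [IHi IH]].
  rewrite big_nil; split.
    apply: (eq_integrable _ (cst 0%E)) => // [x _|]; first by rewrite big_nil.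
    exact: integrable0.
  by under eq_integral do rewrite big_nil; rewrite integral0.
split.
  apply: (eq_integrable _ (fun x => (c i * \1_(A i) x)%:E +
      (\sum_(j <- s) c j * \1_(A j) x)%:E)%E) => // [x _|].
    by rewrite big_cons EFinD.
  exact: integrableD.
under eq_integral do rewrite big_cons EFinD.
rewrite integralD// IH big_cons EFinD; congr (_ + _)%E.
under eq_integral do rewrite EFinM.
rewrite integralZl//; last exact: integrable_indic.
rewrite integral_indic// setIT EFinM fineK//.
by rewrite fin_num_measure.
Qed.

(** Almost surely [f (X x)] is the sum of [f v] times the indicator of [X = v] over the list. This
    reduces the size bias identity to finite sums. *)
Lemma expectation_finite_range (X : T -> R) (s : seq R) (f : R -> R) :
  measurable_fun setT X -> measurable_fun setT f ->
  uniq s -> {ae P, forall x, X x \in s} ->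
  ('E_P[fun x => f (X x)] =
   (\sum_(v <- s) f v * fine (P (X @^-1` [set v])))%R%:E)%E.
Proof.
move=> mX mf us Xs.
have mXv v : measurable (X @^-1` [set v]).
  by rewrite -[_ @^-1` _]setTI; exact: mX.
rewrite -expectation_sum_indic// unlock.
apply: ae_eq_integral => //.
- by apply/measurable_EFinP; exact: measurableT_comp.
- apply/measurable_EFinP; apply: measurable_sum => v; apply: measurable_funM => //.
- apply: filterS Xs => x Xs _; congr EFin.
  rewrite (bigD1_seq (X x))//= indicE mem_set//= mulr1.
  rewrite big1 ?addr0// => v vX; rewrite indicE memNset ?mulr0//=.
  by move=> Xv; rewrite Xv eqxx in vX.
Qed.

End SimpleExpectation.

Lemma exists_mixture {R : realType} {d : measure_display} {T : measurableType d}
    (m : nat) (nu : 'I_m -> probability T R) (p : 'I_m -> R) :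
  (forall a, 0 <= p a) -> \sum_(a < m) p a = 1 ->
  exists P' : probability T R,
    forall A, P' A = (\sum_(a < m) (p a)%:E * nu a A)%E.
Proof.
move=> p0 p1.
have [a0 _] : exists a : 'I_m, True.
  case: m nu p p0 p1 => [|m] nu p p0; last by exists ord0.
  by rewrite big_ord0 => /esym/eqP; rewrite oner_eq0.
(* [msum] is indexed by natural numbers; those that are not below [m] get the zero measure. *)
pose mu k : {measure set T -> \bar R} :=
  if insub k is Some a then mscale (NngNum (p0 a)) (nu a) else mzero.
have muE A : msum mu m A = (\sum_(a < m) (p a)%:E * nu a A)%E.
  by apply: eq_bigr => a _; rewrite /mu valK.
have [||P' P'E] := @exists_normalized R _ T (nu a0) (msum mu m) 1.
- transitivity (msum mu m setT) => //; rewrite -p1 muE -sumEFin.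
  by apply: eq_bigr => a _; rewrite probability_setT mule1.
- by [].
- by exists P' => A; rewrite P'E invr1 mule1; exact: muE.
Qed.

Section SizeBiasMixture.
Context {R : realType} {d : measure_display} {T : measurableType d}.
Variables (P : probability T R) (m : nat) (w : 'I_m -> R) (C : 'I_m -> set T).
Hypotheses (m_gt0 : (0 < m)%N) (w_gt0 : forall a, 0 < w a).
Hypotheses (mC : forall a, measurable (C a)) (PC_gt0 : forall a, (0 < P (C a))%E).

Let Y0 x := \sum_(a < m) w a * \1_(C a) x.

Let mY0 : measurable_fun setT Y0.
Proof.
by apply: measurable_sum => a; apply: measurable_funM => //; exact: measurable_indic.
Qed.

Let mY0V A : measurable A -> measurable (Y0 @^-1` A).
Proof. by move=> mA; rewrite -[_ @^-1` _]setTI; exact: mY0. Qed.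

Let r a := fine (P (C a)).

Let r_gt0 a : 0 < r a.
Proof. by rewrite fine_gt0// PC_gt0/= ltey_eq fin_num_measure. Qed.

Let mu := \sum_(a < m) w a * r a.

Let mu_gt0 : 0 < mu.
Proof.
rewrite /mu (bigD1 (Ordinal m_gt0))//= ltr_wpDr//; last by rewrite mulr_gt0.
by apply: sumr_ge0 => a _; rewrite mulr_ge0// ltW.
Qed.

Let EY0 : ('E_P[Y0] = mu%:E)%E.
Proof. exact: expectation_sum_indic. Qed.

(** All subset sums of the weights, hence every possible value of [Y0]. *)
Let vals : seq R :=
  undup [seq \sum_(a < m) w a * (b a)%:R | b : {ffun 'I_m -> bool}].

Let Y0_vals x : Y0 x \in vals.
Proof.
rewrite mem_undup; apply/mapP; exists [ffun a => x \in C a].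
  by rewrite mem_enum.
by apply: eq_bigr => a _; rewrite ffunE indicE.
Qed.

(* Both sides are the expectation of [Y0 1(Y0 = v)]. *)
Let sum_cond v :
  v * fine (P (Y0 @^-1` [set v])) =
  \sum_(a < m) w a * fine (P (Y0 @^-1` [set v] `&` C a)).
Proof.
have mv : measurable (Y0 @^-1` [set v]) by exact: mY0V.
apply: EFin_inj.
have -> : ((v * fine (P (Y0 @^-1` [set v])))%:E =
    'E_P[fun x => (\sum_(i <- [:: tt]) v * \1_(Y0 @^-1` [set v]) x)%R])%E.
  by rewrite expectation_sum_indic// big_seq1.
rewrite -expectation_sum_indic; last by move=> a; exact: measurableI.
congr ('E_P[_])%E; apply/funext => x; rewrite big_seq1.
under eq_bigr do rewrite indicI/= mulrCA.
rewrite -mulr_sumr indicE; case: (boolP (_ \in _)) => [|_]; last first.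
  by rewrite mul0r mulr0.
by rewrite inE /= => <-; rewrite mulr1 mul1r.
Qed.

(** Mix the [nu a] with weights [w a * r a / mu]. The first marginal is common to all of them and
    survives; by [sum_cond] the second gives [v] the mass v P(Y0 = v) / mu, which is the size-biased
    law. The almost sure bound passes to a finite mixture. *)
Lemma size_bias_mixture (K : R) (nu : 'I_m -> probability (R * R)%type R) :
  (forall a A, measurable A -> nu a (fst @^-1` A) = P (Y0 @^-1` A)) ->
  (forall a A, measurable A ->
    nu a (snd @^-1` A) = (cond_prob P (Y0 @^-1` A) (C a))%:E) ->
  (forall a, {ae nu a, forall z, z.2 <= z.1 + K}) ->
  size_bias_coupling_le P Y0 K.
Proof.
move=> nu1 nu2 nuK.
pose p a := w a * r a / mu.
have p0 a : 0 <= p a by rewrite divr_ge0 ?mulr_ge0// ltW.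
have p1 : \sum_(a < m) p a = 1 by rewrite -mulr_suml divff// gt_eqF.
have [P' P'E] := exists_mixture nu p0 p1.
have P'1 A : measurable A -> P' (fst @^-1` A) = P (Y0 @^-1` A).
  move=> mA; rewrite P'E; under eq_bigr do rewrite nu1//.
  rewrite -ge0_sume_distrl; last by move=> a _; rewrite lee_fin.
  by rewrite sumEFin p1 mul1e.
have P'2 A : measurable A ->
    P' (snd @^-1` A) = ((\sum_(a < m) w a * fine (P (Y0 @^-1` A `&` C a))) / mu)%:E.
  move=> mA; rewrite P'E mulr_suml -sumEFin; apply: eq_bigr => a _.
  rewrite nu2// -EFinM; congr EFin; rewrite /p /cond_prob -/(r a).
  by have := r_gt0 a; have := mu_gt0 => ? ?; field; rewrite !gt_eqF.
exists _, (R * R)%type, P'.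
have mfst : measurable_fun setT (fst : R * R -> R) by [].
have msnd : measurable_fun setT (snd : R * R -> R) by [].
pose Y : {RV P' >-> R} :=
  HB.pack (fst : R * R -> R) (isMeasurableFun.Build _ _ _ _ _ mfst).
pose Ys : {RV P' >-> R} :=
  HB.pack (snd : R * R -> R) (isMeasurableFun.Build _ _ _ _ _ msnd).
exists Y, Ys; split.
- by move=> A mA; rewrite P'1.
- split.
  + apply: aeW => x; apply: sumr_ge0 => a _.
    by rewrite mulr_ge0// ltW.
  + by rewrite EY0 lte_fin mu_gt0 ltry.
  + move=> f mf _ _.
    rewrite EY0.
    rewrite (@expectation_finite_range _ _ _ P Y0 vals (fun v => v * f v))//;
      last 3 first.
    * exact: measurable_funM.
    * exact: undup_uniq.
    * exact: aeW.
    rewrite (@expectation_finite_range _ _ _ P' snd vals f)//; last 2 first.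
    * exact: undup_uniq.
    (* The second coordinate stays in [vals] almost surely, since [Y0] never leaves it. *)
    * have mvals : measurable [set` vals].
        apply: countable_measurable => //.
        by apply: finite_set_countable; exact: finite_seq.
      exists (snd @^-1` (~` [set` vals])); split.
      - by rewrite -[_ @^-1` _]setTI; exact: (msnd measurableT _ (measurableC mvals)).
      - rewrite P'2; last exact: measurableC.
        rewrite big1 ?mul0r// => a _.
        rewrite (_ : _ `&` _ = set0) ?measure0 ?mulr0//.
        by rewrite -subset0 => x [/=]; rewrite Y0_vals.
      - by move=> z.
    rewrite -EFinM mulr_sumr; congr EFin; apply: eq_bigr => v _.
    rewrite mulrAC sum_cond.
    have -> : P' (snd @^-1` [set v]) =
        ((\sum_(a < m) w a * fine (P (Y0 @^-1` [set v] `&` C a))) / mu)%:E.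
      exact: P'2.
    by rewrite /=; have := mu_gt0 => ?; field; rewrite gt_eqF.
- have mK : measurable [set z : R * R | z.2 <= z.1 + K].
    rewrite -[X in measurable X]setTI; apply: measurable_fun_le => //.
    exact: measurable_funD.
  exists (~` [set z : R * R | z.2 <= z.1 + K]); split => //.
    exact: measurableC.
  rewrite P'E big1// => a _.
  have [N [mN N0 KN]] := nuK a.
  rewrite (subset_measure0 _ _ KN N0) ?mule0//.
  exact: measurableC.
Qed.

End SizeBiasMixture.

(** * Mixtures of the conditioned configurations *)

(** Countable additivity over integer fibers, coded into natural numbers by [pickle]; codes that are
    not attained contribute empty fibers. *)
Lemma eq_measure_int_fibers {R : realType} {d d' : measure_display}
    {T : measurableType d} {T' : measurableType d'}
    (mu : {measure set T -> \bar R}) (mu' : {measure set T' -> \bar R})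
    (q : T -> int) (q' : T' -> int) (A : set T) (A' : set T') :
  (forall a, measurable (A `&` q @^-1` [set a])) ->
  (forall a, measurable (A' `&` q' @^-1` [set a])) ->
  (forall a, mu (A `&` q @^-1` [set a]) = mu' (A' `&` q' @^-1` [set a])) ->
  mu A = mu' A'.
Proof.
move=> mA mA' AA'.
have fiberE X (f : X -> int) a : (pickle \o f) @^-1` [set pickle a] = f @^-1` [set a].
  apply/seteqP; split=> x /=; last by move=> ->.
  exact: (pcan_inj pickleK).
have fiber0 X (f : X -> int) k : (forall a : int, pickle a <> k) ->
    (pickle \o f) @^-1` [set k] = set0.
  by move=> nk; rewrite -subset0 => x /= /nk.
have pickleP (k : nat) :
    (exists a : int, pickle a = k) \/ (forall a : int, pickle a <> k).
  by have [|/forallNP] := pselect (exists a : int, pickle a = k); [left|right].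
rewrite (measure_fibers _ (N := pickle \o q)) => [|k]; last first.
  have [[a <-]|k0] := pickleP k; first by rewrite fiberE.
  by rewrite fiber0// setI0.
rewrite (measure_fibers _ (N := pickle \o q')) => [|k]; last first.
  have [[a <-]|k0] := pickleP k; first by rewrite fiberE.
  by rewrite fiber0// setI0.
apply: eq_eseriesr => k _.
have [[a <-]|k0] := pickleP k; first by rewrite !fiberE.
by rewrite !fiber0// !setI0 !measure0.
Qed.

Section ConditionalMixture.
Context {R : realType} {dT dE dL dV : measure_display}.
Context {T : measurableType dT} {E : measurableType dE}.
Context {TL : measurableType dL} {TV : measurableType dV}.
Variables (P PC : probability T R) (L : probability TL R) (Q : probability TV R).
Variables (U : T -> E) (M : T -> int) (q : TL -> int) (V : int -> TV -> E).
Variable D : set int.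
Hypotheses (mU : measurable_fun setT U) (mM : measurable_fun setT M).
Hypothesis V_law : forall a, int_support P M a ->
  has_cond_law Q (V a) P U (M @^-1` [set a]).
Hypothesis mq : forall a, measurable (q @^-1` [set a]).
Hypothesis q_support : forall t, int_support P M (q t).

(** Fixing the index turns the event into a rectangle, whose product measure factorizes. *)
Lemma mixture_fiberE (A : set E) a :
  [set z : TL * TV | A (V (q z.1) z.2)] `&` [set z | q z.1 = a] =
  (q @^-1` [set a]) `*` (V a @^-1` A).
Proof. by apply/seteqP; split=> -[t x] /= [] => [+ <-|-> ]. Qed.

Lemma measurable_mixture_fiber (A : set E) a : measurable A ->
  measurable ([set z : TL * TV | A (V (q z.1) z.2)] `&` [set z | q z.1 = a]).
Proof.
(* [V a] is known to be measurable only for [a] in the support; the values of [q] lie there, and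
   other fibers are empty. *)
move=> mA; have [[t qt]|nq] := pselect (exists t, q t = a); last first.
  rewrite (_ : _ `&` _ = set0)//.
  by rewrite -subset0 => z [_ /= qz]; apply: nq; exists z.1.
have [mV _] : has_cond_law Q (V a) P U (M @^-1` [set a]).
  by apply: V_law; rewrite -qt.
rewrite mixture_fiberE; apply: measurableX => //.
by rewrite -[_ @^-1` _]setTI; exact: mV.
Qed.

Lemma measurable_mixture :
  measurable_fun setT (fun z : TL * TV => V (q z.1) z.2).
Proof.
move=> _ A mA; rewrite setTI.
rewrite (_ : _ @^-1` _ = \bigcup_(a : int)
   ([set z : TL * TV | A (V (q z.1) z.2)] `&` [set z | q z.1 = a])).
  apply: countable_bigcupT_measurable => // a.
  exact: measurable_mixture_fiber.
by apply/seteqP; split=> [z Az|z [a _ []]//]; exists (q z.1).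
Qed.

Hypothesis PC_law : forall A, measurable A ->
  PC A = (cond_prob P A (M @^-1` D))%:E.
Hypothesis q_law : forall a, L (q @^-1` [set a]) = PC (M @^-1` [set a]).

(** Law of total probability: the fiber over [a] has measure P(M = a | D) P(U in A | M = a), which
    is P(U in A, M = a | D). Off the support both sides vanish. *)
Lemma mixture_law (A : set E) : measurable A ->
  (L \x Q)%E [set z : TL * TV | A (V (q z.1) z.2)] = PC (U @^-1` A).
Proof.
move=> mA.
have mUA : measurable (U @^-1` A) by rewrite -[_ @^-1` _]setTI; exact: mU.
have mM1 a : measurable (M @^-1` [set a]) by exact: measurable_int_preimage.
apply: (@eq_measure_int_fibers _ _ _ _ _ _ _ (fun z => q z.1) M) => a.
- exact: measurable_mixture_fiber.
- exact: measurableI.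
transitivity ((L \x Q)%E ((q @^-1` [set a]) `*` (V a @^-1` A))).
  by rewrite -mixture_fiberE.
have [Sa|nSa] := pselect (int_support P M a); last first.
  have q0 : q @^-1` [set a] = set0.
    by rewrite -subset0 => t /= qt; apply: nSa; rewrite -qt.
  have Ma0 : PC (M @^-1` [set a]) = 0%E by rewrite -q_law q0 measure0.
  rewrite q0 set0X measure0; apply/esym/(subset_measure0 _ _ _ Ma0) => //.
  exact: measurableI.
have [mV VE] := V_law Sa.
rewrite product_measure1E//; last by rewrite -[_ @^-1` _]setTI; exact: mV.
rewrite [X in (X * _)%E]q_law [X in (_ * X)%E]VE//.
rewrite (PC_law (mM1 a)) [RHS](PC_law (measurableI _ _ mUA (mM1 a))).
rewrite -EFinM; congr EFin; rewrite /cond_prob.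
(* The event [M = a] is either disjoint from the conditioning event or contained in it. *)
have [Da|nDa] := pselect (D a); last first.
  have MaD : M @^-1` [set a] `&` M @^-1` D = set0.
    by rewrite -subset0 => x [/= ->].
  by rewrite -setIA MaD setI0 measure0 !mul0r.
have MaD : M @^-1` [set a] `&` M @^-1` D = M @^-1` [set a].
  by apply: setIidl => x /= ->.
rewrite -setIA MaD -/(int_pmf P M a) mulrC mulrA divfK//.
by rewrite gt_eqF.
Qed.

End ConditionalMixture.

Section CoupledPair.
Context {R : realType} {dT dE dL dV : measure_display}.
Context {T : measurableType dT} {E : measurableType dE}.
Context {TL : measurableType dL} {TV : measurableType dV}.
Variables (P PC : probability T R) (L : probability TL R) (Q : probability TV R).
Variables (U : T -> E) (M : T -> int) (q qC : TL -> int) (V : int -> TV -> E).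
Variables (D : set int) (s : E -> R) (K : R).
Hypotheses (mU : measurable_fun setT U) (mM : measurable_fun setT M).
Hypothesis ms : measurable_fun setT s.
Hypothesis V_law : forall a, int_support P M a ->
  has_cond_law Q (V a) P U (M @^-1` [set a]).
Hypothesis PC_law : forall A, measurable A ->
  PC A = (cond_prob P A (M @^-1` D))%:E.
Hypotheses (mq : forall a, measurable (q @^-1` [set a]))
  (mqC : forall a, measurable (qC @^-1` [set a])).
Hypotheses (q_support : forall t, int_support P M (q t))
  (qC_support : forall t, int_support P M (qC t)).
Hypotheses (q_law : forall a, L (q @^-1` [set a]) = P (M @^-1` [set a]))
  (qC_law : forall a, L (qC @^-1` [set a]) = PC (M @^-1` [set a])).
Hypothesis sV_le : forall t,
  {ae Q, forall x, s (V (qC t) x) <= s (V (q t) x) + K}.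

(** The same point of the product space drives both configurations; [nu] is the joint law of the two
    sums. *)
Lemma exists_coupled_pair : exists nu : probability (R * R)%type R,
  [/\ forall A, measurable A -> nu (fst @^-1` A) = P ((s \o U) @^-1` A),
      forall A, measurable A ->
        nu (snd @^-1` A) = (cond_prob P ((s \o U) @^-1` A) (M @^-1` D))%:E
    & {ae nu, forall z, z.2 <= z.1 + K}].
Proof.
pose Y (z : TL * TV) := s (V (q z.1) z.2).
pose YC (z : TL * TV) := s (V (qC z.1) z.2).
have mY : measurable_fun setT Y.
  by apply: (measurableT_comp ms); exact: (measurable_mixture V_law mq q_support).
have mYC : measurable_fun setT YC.
  by apply: (measurableT_comp ms); exact: (measurable_mixture V_law mqC qC_support).
have mYY : measurable_fun setT (fun z => (Y z, YC z)).
  exact: measurable_fun_pair.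
pose YY : {mfun (TL * TV)%type >-> (R * R)%type} :=
  HB.pack (fun z => (Y z, YC z)) (isMeasurableFun.Build _ _ _ _ _ mYY).
have msV A : measurable A -> measurable (s @^-1` A).
  by move=> mA; rewrite -[_ @^-1` _]setTI; exact: ms.
(* The unconditional law is the case [D = setT] of [mixture_law]. *)
have PT_law A : measurable A -> P A = (cond_prob P A (M @^-1` setT))%:E.
  move=> mA; rewrite /cond_prob preimage_setT setIT probability_setT divr1.
  by rewrite fineK// fin_num_measure.
exists (distribution (L \x Q)%E YY); split.
- move=> A mA.
  exact: (mixture_law mU mM V_law mq q_support PT_law q_law (msV _ mA)).
- move=> A mA; rewrite -PC_law; last first.
    rewrite -[_ @^-1` _]setTI.
    exact: (measurableT_comp ms mU).
  exact: (mixture_law mU mM V_law mqC qC_support PC_law qC_law (msV _ mA)).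
- have mK : measurable [set z : R * R | z.2 <= z.1 + K].
    rewrite -[X in measurable X]setTI; apply: measurable_fun_le => //.
    exact: measurable_funD.
  exists (~` [set z : R * R | z.2 <= z.1 + K]); split => //.
    exact: measurableC.
  (* The product measure integrates the measures of the sections, and each section of the
     exceptional set is null by [sV_le]. *)
  rewrite /distribution /pushforward /=.
  rewrite /product_measure1 /=; apply: integral0_eq => t _ /=.
  have [N [mN N0 sN]] := sV_le t.
  apply: (subset_measure0 _ mN _ N0).
    apply: measurable_xsection.
    rewrite -[_ @^-1` _]setTI; exact: (mYY measurableT _ (measurableC mK)).
  by move=> x; rewrite /xsection/= inE /= => nle; apply: sN.
Qed.

End CoupledPair.

(** * Assembly of the size bias coupling *)

Section QuantileCoupling.
Context {R : realType} {m : nat} {dT dE : measure_display}.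
Context {T : measurableType dT} {E : measurableType dE}.
Variables (m_gt0 : (0 < m)%N) (P : probability T R) (U : T -> E).
Variables (F : E -> 'I_m -> int) (M : 'I_m -> T -> int) (w : 'I_m -> R).
Variables (dV : 'I_m -> measure_display).
Variables (TV : forall alpha, measurableType (dV alpha)).
Variables (Q : forall alpha, probability (TV alpha) R).
Variables (V : forall alpha, int -> TV alpha -> E).
Variables (chi : 'I_m -> int -> bool) (K : R).
Hypothesis mU : measurable_fun setT U.
Hypothesis mF : forall alpha, measurable_fun setT (fun e => F e alpha).
Hypothesis ME : forall alpha x, M alpha x = F (U x) alpha.
Hypothesis w_gt0 : forall alpha, 0 < w alpha.
Hypothesis V_law : forall alpha a, int_support P (M alpha) a ->
  has_cond_law (Q alpha) (@V alpha a) P U (M alpha @^-1` [set a]).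
Hypothesis chi_gt0 : forall alpha, (0 < P [set x | chi alpha (M alpha x)])%E.

Let s e := \sum_(b < m) w b * (chi b (F e b))%:R.

Hypothesis sV_le : forall alpha (PC : probability T R) x0 u,
  (forall A, measurable A ->
    PC A = (cond_prob P A (M alpha @^-1` [set a | chi alpha a]))%:E) ->
  int_support P (M alpha) (int_quantile P (M alpha) x0 u) ->
  int_support P (M alpha) (int_quantile PC (M alpha) x0 u) ->
  {ae Q alpha, forall x,
     s (@V alpha (int_quantile PC (M alpha) x0 u) x) <=
     s (@V alpha (int_quantile P (M alpha) x0 u) x) + K}.

(** Both claims of the theorem are instances, through [chi], and only the bound [sV_le] remains to
    be checked. That bound is stated for all [PC] and [x0] because both are chosen inside this
    proof. *)
Lemma quantile_size_bias_coupling :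
  size_bias_coupling_le P (fun x => \sum_(b < m) w b * (chi b (M b x))%:R) K.
Proof.
have mM alpha : measurable_fun setT (M alpha).
  rewrite (_ : M alpha = (fun e => F e alpha) \o U).
    exact: (measurableT_comp (mF alpha) mU).
  by apply/funext => x; exact: ME.
pose C alpha := M alpha @^-1` [set a | chi alpha a].
have mC alpha : measurable (C alpha) by exact: measurable_int_preimage.
have Y0E : (fun x => \sum_(b < m) w b * (chi b (M b x))%:R) =
    (fun x => \sum_(b < m) w b * \1_(C b) x).
  apply/funext => x; apply: eq_bigr => b _; rewrite indicE; congr (_ * _%:R).
  by congr nat_of_bool; apply/idP/idP; rewrite inE.
have Y0s : (fun x => \sum_(b < m) w b * \1_(C b) x) = s \o U.
  by rewrite -Y0E; apply/funext => x; apply: eq_bigr => b _; rewrite ME.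
have ms : measurable_fun setT s.
  apply: measurable_sum => b; apply: measurable_funM => //.
  rewrite (_ : (fun _ => _) = \1_[set e | chi b (F e b)]); last first.
    apply/funext => e; rewrite indicE; congr (_%:R).
    by congr nat_of_bool; apply/idP/idP; rewrite inE.
  apply: measurable_indic.
  exact: (measurable_int_preimage (mF b) [set a | chi b a]).
have [L LE] := exists_uniform_probability R.
have nuP alpha : exists nu : probability (R * R)%type R,
  [/\ forall A, measurable A -> nu (fst @^-1` A) = P ((s \o U) @^-1` A),
      forall A, measurable A ->
        nu (snd @^-1` A) = (cond_prob P ((s \o U) @^-1` A) (C alpha))%:E
    & {ae nu, forall z, z.2 <= z.1 + K}].
  have [PC PCE] := exists_cond_probability (mC alpha) (chi_gt0 alpha).
  (* Conditioning only shrinks the support, so one default [x0] from the conditional support serves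
     both quantiles. *)
  have PC_support a : int_support PC (M alpha) a -> int_support P (M alpha) a.
    rewrite /int_support /= => PCa; rewrite lt0r int_pmf_ge0 andbT.
    apply/eqP => Pa; move: PCa; rewrite /int_pmf PCE; last exact: measurable_int_preimage.
    have Ma0 : P (M alpha @^-1` [set a]) = 0%E by rewrite -int_pmfE// Pa.
    have -> : cond_prob P (M alpha @^-1` [set a]) (C alpha) = 0.
      rewrite /cond_prob [X in fine X](subset_measure0 _ _ (@subIsetl _ _ _) Ma0).
      - by rewrite mul0r.
      - by apply: measurableI => //; exact: measurable_int_preimage.
      - exact: measurable_int_preimage.
    by rewrite ltxx.
  have [x0 PCx0] : exists x0, int_support PC (M alpha) x0.
    (* A median: any level in ]0, 1[ yields a point with a positive jump. *)
    have [|x0 /andP[lt le]] := @int_cdf_bracket _ _ _ PC (M alpha) 2^-1 (mM alpha).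
      by lra.
    exists x0; have := lt_le_trans lt le.
    by rewrite (int_cdfD1 PC (mM alpha) x0) ltrDl.
  have q_support u : int_support P (M alpha) (int_quantile P (M alpha) x0 u).
    by apply: int_quantile_support => //; exact: PC_support.
  have qC_support u : int_support P (M alpha) (int_quantile PC (M alpha) x0 u).
    by apply/PC_support/int_quantile_support.
  apply: (@exists_coupled_pair _ _ _ _ _ _ _ _ _ P PC L (Q alpha) U (M alpha)
    (int_quantile P (M alpha) x0) (int_quantile PC (M alpha) x0) (@V alpha)) => //.
  - by move=> a; exact: V_law.
  - by move=> a; exact: measurable_int_quantile.
  - by move=> a; exact: measurable_int_quantile.
  - by move=> a; exact: int_quantile_law.
  - by move=> a; exact: int_quantile_law.
  - by move=> u; exact: sV_le.
have [nu nuE] := choice nuP.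
rewrite Y0E.
apply: (@size_bias_mixture _ _ _ P m w C m_gt0 w_gt0 mC chi_gt0 K nu) => //.
- by move=> alpha A mA; rewrite Y0s; case: (nuE alpha) => nu1 _ _; exact: nu1.
- by move=> alpha A mA; rewrite Y0s; case: (nuE alpha) => _ nu2 _; exact: nu2.
- by move=> alpha; case: (nuE alpha).
Qed.

End QuantileCoupling.

(** * Support minima, iterated unit steps and the theorem *)

Lemma le_maxf {R : realType} (m : nat) (v : 'I_m -> R) b : v b <= maxf v.
Proof. exact: le_bigmax. Qed.

(** The floor of the finite infimum bounds the support below, so a least offset from it exists. The
    last conjunct turns bounds by [d - a0] into bounds by [d] minus the infimum. *)
Lemma exists_min_support {R : realType} {d : measure_display} {T : measurableType d}
    (P : probability T R) (M : T -> int) :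
  int_support P M !=set0 -> (-oo < inf_support P M)%E ->
  exists a0 : int, [/\ int_support P M a0,
    forall a, int_support P M a -> a0 <= a
    & fine (inf_support P M) <= a0%:~R].
Proof.
move=> [s0 Ss0] infNy.
have inf_le a : int_support P M a -> (inf_support P M <= (a%:~R : R)%:E)%E.
  by move=> Sa; apply: ereal_inf_lbound; exists a.
have [r infE] : exists r : R, inf_support P M = r%:E.
  move: infNy (inf_le _ Ss0); case: (inf_support P M) => [r _ _|//|//].
  by exists r.
have fle a : int_support P M a -> Num.floor r <= a.
  move=> Sa; have := inf_le _ Sa; rewrite infE lee_fin => ra.
  by rewrite -(ler_int R) (le_trans (floor_le _)).
have ex : exists n : nat, `[< int_support P M (Num.floor r + n%:Z) >].
  exists (absz (s0 - Num.floor r)%R); apply/asboolP.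
  have -> : Num.floor r + (absz (s0 - Num.floor r)%R)%:Z = s0.
    by have := fle _ Ss0; lia.
  exact: Ss0.
have [n /asboolP Sn nmin] := ex_minnP ex.
exists (Num.floor r + n%:Z); split=> //.
- move=> a Sa; have fa := fle _ Sa.
  have : (n <= absz (a - Num.floor r)%R)%N.
    apply: nmin; apply/asboolP.
    by have -> : Num.floor r + (absz (a - Num.floor r)%R)%:Z = a by lia.
  lia.
- by have := inf_le _ Sn; rewrite infE lee_fin.
Qed.

Lemma int_cdf_eq0 {R : realType} {d : measure_display} {T : measurableType d}
    (P : probability T R) (M : T -> int) a : measurable_fun setT M ->
  (forall x, int_support P M x -> a < x) -> int_cdf P M a = 0.
Proof.
move=> mM aS; apply: EFin_inj; rewrite int_cdf_series// eseries0// => k _ _.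
congr EFin; apply/eqP; rewrite eq_le int_pmf_ge0 andbT leNgt; apply/negP.
by move=> /aS; lia.
Qed.

(** Chains [n] unit steps; the interval shape of [S] keeps the intermediate indices in [S]. *)
Lemma property_ge_iter {R : realType} {m : nat} {d : measure_display}
    {T : measurableType d} (Q : probability T R) (S : set int)
    (N : int -> T -> 'I_m -> int) (B : R) (alpha : 'I_m) (n : nat) a
    (w : 'I_m -> R) (c : 'I_m -> int) :
  (forall s x t, S s -> S t -> s <= x <= t -> S x) ->
  property_ge Q S N B alpha -> (forall b, 0 < w b) -> S a -> S (a + n%:Z) ->
  {ae Q, forall x,
    \sum_(b < m | b != alpha) w b * (c b <= N (a + n%:Z) x b)%R%:R <=
    \sum_(b < m | b != alpha) w b * (c b <= N a x b)%R%:R + maxf w * (B * n%:R)}.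
Proof.
move=> convS pB w0 Sa; elim: n => [|n IH] San.
  by apply: aeW => x; rewrite !mulr0 !addr0.
have San1 : S (a + n%:Z) by apply: (convS a _ (a + n.+1%:Z)) => //; lia.
have San2 : S (a + n%:Z + 1) by have -> : a + n%:Z + 1 = a + n.+1%:Z by lia.
have := pB _ San1 San2 w c w0; have := IH San1.
apply: filterS2 => x; have -> : a + n%:Z + 1 = a + n.+1%:Z by lia.
by rewrite -natr1; lra.
Qed.

Theorem theorem2p1 (R : realType) (m : nat) (m_gt0 : (0 < m)%N)
  (dT : measure_display) (T : measurableType dT) (P : probability T R)
  (dE : measure_display) (E : measurableType dE)
  (U : {RV P >-> E})
  (F : E -> 'I_m -> int)
  (mF : forall alpha, measurable_fun setT (fun e => F e alpha))
  (M : 'I_m -> T -> int)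
  (ME : forall alpha x, M alpha x = F (U x) alpha)
  (M_lc : forall alpha, lattice_log_concave P (M alpha))
  (w : 'I_m -> R) (w_gt0 : forall alpha, 0 < w alpha)
  (d : 'I_m -> int)
  (* the configurations U_a^alpha, a in S_alpha, on the space TV alpha *)
  (dV : 'I_m -> measure_display)
  (TV : forall alpha, measurableType (dV alpha))
  (Q : forall alpha, probability (TV alpha) R)
  (V : forall alpha, int -> TV alpha -> E)
  (V_law : forall alpha a, int_support P (M alpha) a ->
     has_cond_law (Q alpha) (V alpha a) P U (M alpha @^-1` [set a]))
  (B : R) (B_ge0 : 0 <= B) :
  ((forall alpha, (0 < P [set x | (d alpha <= M alpha x)%R] < 1)%E) ->
   (forall alpha, property_ge (Q alpha) (int_support P (M alpha))
                    (fun a x => F (V alpha a x)) B alpha) ->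
   (forall alpha, (-oo < inf_support P (M alpha))%E) ->
   size_bias_coupling_le P
     (fun x => \sum_(alpha < m) w alpha * (d alpha <= M alpha x)%R%:R)
     (maxf w *
      (B * maxf (fun alpha =>
                   (d alpha)%:~R - fine (inf_support P (M alpha))) + 1)))
  /\
  ((forall alpha, (0 < P [set x | M alpha x != d alpha] < 1)%E) ->
   (forall alpha, property_ne (Q alpha) (int_support P (M alpha))
                    (fun a x => F (V alpha a x)) B alpha) ->
   size_bias_coupling_le P
     (fun x => \sum_(alpha < m) w alpha * (M alpha x != d alpha)%:R)
     (maxf w * (B + 1))).
Proof.
have w_le alpha : w alpha <= maxf w by exact: le_maxf.
have maxw0 : 0 <= maxf w by rewrite (le_trans (ltW (w_gt0 (Ordinal m_gt0)))).
have mM alpha : measurable_fun setT (M alpha).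
  rewrite (_ : M alpha = (fun e => F e alpha) \o U).
    exact: (measurableT_comp (mF alpha)).
  by apply/funext => x; exact: ME.
(* Restores the omitted term [alpha], which can grow by at most [w alpha]. *)
have split_le (chi : 'I_m -> int -> bool) alpha (N N' : 'I_m -> int) K :
    \sum_(b < m | b != alpha) w b * (chi b (N' b))%:R <=
    \sum_(b < m | b != alpha) w b * (chi b (N b))%:R + K ->
    \sum_(b < m) w b * (chi b (N' b))%:R <=
    \sum_(b < m) w b * (chi b (N b))%:R + (K + maxf w).
  move=> le; rewrite (bigD1 alpha)// [in leRHS](bigD1 alpha)//=.
  have w1 : w alpha * (chi alpha (N' alpha))%:R <= maxf w.
    rewrite (le_trans _ (w_le alpha))// ler_piMr ?(ltW (w_gt0 _))//.
    by case: (chi _ _).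
  have w2 : 0 <= w alpha * (chi alpha (N alpha))%:R.
    by rewrite mulr_ge0// ltW.
  lra.
split=> [Pd pB infNy|Pd pB].
- pose chi (alpha : 'I_m) (a : int) := (d alpha <= a)%R.
  apply: (@quantile_size_bias_coupling R m dT dE T E m_gt0 P U F M w dV TV Q V chi) => //.
    by move=> alpha; case/andP: (Pd alpha).
  move=> alpha PC x0 u PCE Sq Sq'.
  have [a0 [Sa0 a0_min a0_inf]] := exists_min_support (ex_intro _ _ Sq) (infNy alpha).
  have Fa0 : int_cdf P (M alpha) (a0 - 1) = 0.
    by apply: int_cdf_eq0 => // x /a0_min; lia.
  (* Otherwise [M alpha >= d alpha] would have probability one, which [Pd] excludes. *)
  have a0d : a0 <= d alpha.
    rewrite leNgt; apply/negP => da0; have /andP[_] := Pd alpha.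
    have : int_cdf P (M alpha) (d alpha - 1) <= 0.
      by rewrite -Fa0; apply: int_cdf_nondecreasing => //; lia.
    rewrite -lee_fin int_cdfE// => F0.
    have -> : [set x | (d alpha <= M alpha x)%R] =
        ~` (M alpha @^-1` [set x | x <= d alpha - 1]).
      by apply/seteqP; split=> x /=; lia.
    rewrite probability_setC; last exact: measurable_int_preimage.
    have /eqP -> : P (M alpha @^-1` [set x | x <= d alpha - 1]) == 0%E.
      by rewrite eq_le F0 measure_ge0.
    by rewrite sube0 ltxx.
  have PD0 : (0 < P (M alpha @^-1` [set a | chi alpha a]))%E by case/andP: (Pd alpha).
  pose n := absz (d alpha - a0)%R.
  have dE' : d alpha = a0 + n%:Z by rewrite /n; lia.
  set q := int_quantile P (M alpha) x0 u.
  set q' := int_quantile PC (M alpha) x0 u.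
  have qq' : q <= q'.
    rewrite -[q']addr0; apply: int_quantile_le => // a; rewrite addr0.
    by apply: (cond_ge_cdf_le (mM alpha) _ PCE) => //; case/andP: (Pd alpha).
  have q'q : q' <= q + n%:Z.
    apply: int_quantile_le => // a.
    exact: (cond_ge_cdf_shift (mM alpha) (M_lc alpha) PD0 PCE erefl a dE' Fa0).
  pose k := absz (q' - q)%R.
  have q'E : q' = q + k%:Z by rewrite /k; lia.
  (* The number of steps is at most [n = d alpha - a0], where [a0] is at least the infimum. *)
  have kn : k%:R <= maxf (fun alpha => (d alpha)%:~R - fine (inf_support P (M alpha))).
    apply: (le_trans _ (le_maxf _ alpha)).
    have -> : (d alpha)%:~R = a0%:~R + n%:R :> R by rewrite dE' intrD.
    have : k%:R <= n%:R :> R by rewrite ler_nat; lia.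
    lra.
  have Sqk : int_support P (M alpha) (q + k%:Z) by rewrite -q'E.
  have := property_ge_iter d (fun s x t =>
    @lattice_log_concave_interval _ _ _ P _ s x t (M_lc alpha)) (pB alpha) w_gt0 Sq Sqk.
  rewrite -q'E; apply: filterS => x /(split_le chi).
  move=> /le_trans; apply; rewrite lerD2l mulrDr mulr1 lerD2r.
  by rewrite ler_wpM2l// ler_wpM2l.
- pose chi (alpha : 'I_m) (a : int) := a != d alpha.
  apply: (@quantile_size_bias_coupling R m dT dE T E m_gt0 P U F M w dV TV Q V chi) => //.
    by move=> alpha; case/andP: (Pd alpha).
  move=> alpha PC x0 u PCE Sq Sq'.
  set q := int_quantile P (M alpha) x0 u.
  set q' := int_quantile PC (M alpha) x0 u.
  have qq' : q <= q' + 1.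
    apply: int_quantile_le => // a.
    by apply: (cond_neq_cdf_le (mM alpha) (M_lc alpha) _ PCE) => //; case/andP: (Pd alpha).
  have q'q : q' <= q + 1.
    apply: int_quantile_le => // a.
    by apply: (cond_neq_cdf_ge (mM alpha) (M_lc alpha) _ PCE) => //; case/andP: (Pd alpha).
  (* Distinct quantiles are adjacent, in either order, so a single step of [property_ne]
     suffices. *)
  have [->|nq] := eqVneq q' q.
    by apply: aeW => x; rewrite lerDl mulr_ge0// addr_ge0.
  have := pB alpha q q' Sq Sq' _ w d w_gt0.
  move=> /(_ ltac:(lia)); apply: filterS => x /(split_le chi).
  by rewrite mulrDr mulr1.
Qed.
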